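(* Let $0<q<1$, let $f$ be a function on $[0,\infty)$ and $F(s)=L_q(f(t))(s)$. For every $n\in\mathbb{N}$, $$L_q\left(t^nf(t)\right)(s)=(-1)^nq^{\binom n2}\left(\frac{\partial_q}{\partial_qs}\right)^nF\left(q^{-n}s\right),$$ for $s>0$ restricted so that the transforms involved converge, where $\left(\frac{\partial_q}{\partial_qs}\right)^n$ is applied to the function $s\mapsto F(q^{-n}s)$.
   Context: Fix $0<q<1$. $[n]_q=\frac{1-q^n}{1-q}$, $[n]_q!=[n]_q\cdots[1]_q$, $[0]_q!=1$, $E_q(z)=\sum_{n\ge0}\frac{q^{\binom n2}z^n}{[n]_q!}$. The Jackson $q$-derivative in the variable $s$ is $\frac{\partial_q}{\partial_qs}g(s)=\frac{g(s)-g(qs)}{(1-q)s}$. The improper Jackson $q$-integral is $\int_0^\infty f(x)\,d_qx=(1-q)\sum_{n\in\mathbb{Z}}q^nf(q^n)$, and $L_q(f(t))(s)=\int_0^\infty E_q(-qst)f(t)\,d_qt$ ($s>0$) is the $q$-Laplace transform of the first kind. *)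

(* Defs.v *)
From HB Require Import structures.
From mathcomp Require Import all_boot all_order all_algebra.
From mathcomp Require Import all_classical all_reals all_analysis.

Set Implicit Arguments.
Unset Strict Implicit.
Unset Printing Implicit Defensive.

Import Order.TTheory GRing.Theory Num.Theory.
Import numFieldNormedType.Exports.

Local Open Scope ring_scope.
Local Open Scope classical_set_scope.

Definition qnum (R : realType) (q : R) (n : nat) : R :=
  (1 - q ^+ n) / (1 - q).

Definition qfact (R : realType) (q : R) (n : nat) : R :=
  \prod_(1 <= k < n.+1) qnum q k.

(* For 0 < q < 1 this power series converges at every z. *)
Definition qExp (R : realType) (q z : R) : R :=
  limn (series (fun n : nat => q ^+ 'C(n, 2) * z ^+ n / qfact q n)).

Definition qderiv (R : realType) (q : R) (g : R -> R) (s : R) : R :=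
  (g s - g (q * s)) / ((1 - q) * s).

(* A series over the integers converges when its two halves, over k >= 0 and   *)
(* over k < 0, both converge; absolute convergence is not required. The value  *)
(* of intsum is meaningful only under intsum_cvg.                              *)
Definition intsum_cvg (R : realType) (u : int -> R) : Prop :=
  cvgn (series (fun n : nat => u n%:Z)) /\
  cvgn (series (fun n : nat => u (- n.+1%:Z))).

Definition intsum (R : realType) (u : int -> R) : R :=
  limn (series (fun n : nat => u n%:Z)) +
  limn (series (fun n : nat => u (- n.+1%:Z))).

Definition jackson_cvg (R : realType) (q : R) (f : R -> R) : Prop :=
  intsum_cvg (fun k : int => q ^ k * f (q ^ k)).

Definition jackson (R : realType) (q : R) (f : R -> R) : R :=
  (1 - q) * intsum (fun k : int => q ^ k * f (q ^ k)).

Definition qLaplace_cvg (R : realType) (q : R) (f : R -> R) (s : R) : Prop :=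
  jackson_cvg q (fun t : R => qExp q (- (q * s * t)) * f t).

(* Only the values of f at the points q ^ k, all positive, are used, so a      *)
(* function on [0, +oo[ is represented by any extension to R.                  *)
Definition qLaplace (R : realType) (q : R) (f : R -> R) (s : R) : R :=
  jackson q (fun t : R => qExp q (- (q * s * t)) * f t).

(* Main.v *)
(** The q-exponential satisfies E(z) - E(qz) = (1-q) z E(qz), so each
    q-derivative in s of the kernel E(-q a s t) brings down a factor
    -q a t and replaces a by q a. With a = q^-n, after n steps the argument
    of the kernel is back at -q s t, and the accumulated power of q is
    q^(C(n+1,2) - n^2) = q^(- C(n,2)). Only finitely many values of F occur,
    so linearity of the convergent sums over the integers suffices: no
    interchange of limits is needed. *)

Require Import Defs.
From HB Require Import structures.
From mathcomp Require Import all_boot all_order all_algebra.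
From mathcomp Require Import all_classical all_reals all_analysis.
From mathcomp Require Import ring lra zify.

Set Implicit Arguments.
Unset Strict Implicit.
Unset Printing Implicit Defensive.

Import Order.TTheory GRing.Theory Num.Theory.
Import numFieldNormedType.Exports.

Local Open Scope ring_scope.

(** Ratio test: from rank [N] on, the terms are dominated by the geometric sequence [|u N| r^n], and
    the first [N] terms do not affect convergence. *)
Lemma cvg_series_ratio (R : realType) (u : R^nat) (r : R) (N : nat) :
  0 <= r -> r < 1 -> (forall n, (N <= n)%N -> `|u n.+1| <= r * `|u n|) ->
  cvgn (series u).
Proof.
move=> r_ge0 r_lt1 ur.
have uN n : `|u (n + N)%N| <= geometric `|u N| r n.
  elim: n => [|n IHn]; first by rewrite /= expr0 mulr1.
  rewrite addSn (le_trans (ur _ (leq_addl _ _)))//=.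
  by rewrite exprS mulrCA ler_wpM2l.
have cvgN : cvgn (series (fun n => u (n + N)%N)).
  apply: normed_cvg; apply: (series_le_cvg _ _ uN) => [n|n|].
  - exact: normr_ge0.
  - by rewrite /= mulr_ge0// exprn_ge0.
  - by apply: is_cvg_geometric_series; rewrite ger0_norm.
have shiftE : (fun n => series u (n + N)%N) =
    (fun n => series u N + series (fun k => u (k + N)%N) n).
  apply/funext => n; rewrite series_addn; congr (_ + _).
  by rewrite -{1}[N]add0n big_addn addnK.
move/cvg_ex: cvgN => [l ul]; apply/cvg_ex; exists (series u N + l).
rewrite -(cvg_shiftn N) shiftE.
by apply: cvgD => //; exact: cvg_cst.
Qed.

Section qExponential.
Local Open Scope classical_set_scope.
Variables (R : realType) (q : R).
Hypotheses (q_gt0 : 0 < q) (q_lt1 : q < 1).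

Let qexp_coeff (z : R) (n : nat) : R := q ^+ 'C(n, 2) * z ^+ n / qfact q n.

Lemma qnumS_ge1 n : 1 <= qnum q n.+1.
Proof.
rewrite /qnum ler_pdivlMr ?subr_gt0// mul1r lerD2l lerN2 exprS.
by rewrite ger_pMr// exprn_ile1// ltW.
Qed.

Lemma qfactS n : qfact q n.+1 = qfact q n * qnum q n.+1.
Proof. by rewrite /qfact big_nat_recr. Qed.

Lemma qfact_gt0 n : 0 < qfact q n.
Proof.
elim: n => [|n IHn]; first by rewrite /qfact big_geq.
by rewrite qfactS mulr_gt0// (lt_le_trans ltr01) ?qnumS_ge1.
Qed.

Let qexp_coeffS z n :
  qexp_coeff z n.+1 = q ^+ n * z / qnum q n.+1 * qexp_coeff z n.
Proof.
rewrite /qexp_coeff qfactS binS bin1 exprD exprS.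
have := gt_eqF (qfact_gt0 n).
have : qnum q n.+1 != 0 by rewrite gt_eqF// (lt_le_trans ltr01) ?qnumS_ge1.
by move=> ? /negbT ?; field; apply/andP.
Qed.

(** Consecutive terms have ratio [q^n z / [n+1]_q]. As [[n+1]_q >= 1] and [q^n |z|] tends to 0, its
    modulus is eventually at most 1/2, whatever [z] is. *)
Lemma cvg_qExp (z : R) :
  cvgn (series (fun n : nat => q ^+ 'C(n, 2) * z ^+ n / qfact q n)).
Proof.
have q_norm_lt1 : `|q| < 1 by rewrite ger0_norm ?ltW.
have [N _ qN] : \forall n \near \oo, q ^+ n * `|z| < 1/2.
  have : (q ^+ n * `|z|) @[n --> \oo] --> 0 * `|z|.
    by apply: cvgM; [exact: cvg_expr|exact: cvg_cst].
  by rewrite mul0r => /cvgr_lt; apply; lra.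
have half_ge0 : 0 <= 1/2 :> R by lra.
have half_lt1 : 1/2 < 1 :> R by lra.
apply: (cvg_series_ratio half_ge0 half_lt1) => n /qN /= zn.
rewrite -!/(qexp_coeff z _) qexp_coeffS normrM ler_wpM2r//.
rewrite !normrM normfV ler_pdivrMr ?normr_gt0; last first.
  by rewrite gt_eqF// (lt_le_trans ltr01) ?qnumS_ge1.
have := qnumS_ge1 n; have qn_ge0 : 0 <= q ^+ n by rewrite exprn_ge0 ?ltW.
rewrite (ger0_norm qn_ge0) => qn_ge1.
rewrite [`|qnum _ _|]ger0_norm ?(le_trans ler01)//; lra.
Qed.

(** Holds coefficientwise after an index shift: [1 - q^(n+1)] cancels against [[n+1]_q] and leaves
    [1 - q], while [C(n+1,2) = C(n,2) + n] turns [z^n] into [(q z)^n]. *)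
Lemma qExp_qdiff (z : R) :
  qExp q z - qExp q (q * z) = (1 - q) * z * qExp q (q * z).
Proof.
have termE n : qexp_coeff z n.+1 - qexp_coeff (q * z) n.+1 =
    (1 - q) * z * qexp_coeff (q * z) n.
  rewrite /qexp_coeff qfactS binS bin1 exprD !exprMn !exprS /qnum.
  have := gt_eqF (qfact_gt0 n).
  have : 1 - q ^+ n.+1 != 0 by rewrite subr_eq0 gt_eqF// exprn_ilt1// ltW.
  have : 1 - q != 0 by rewrite subr_eq0 gt_eqF.
  by rewrite exprS => ? ? /negbT ?; field; apply/and3P.
(* The left side has one more term: the constant terms of the two series cancel. *)
have sumE n : series (qexp_coeff z) n.+1 - series (qexp_coeff (q * z)) n.+1 =
    (1 - q) * z * series (qexp_coeff (q * z)) n.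
  elim: n => [|n IHn].
    rewrite !seriesSr /series/= !big_geq// /qexp_coeff !expr0; ring.
  rewrite seriesSr (seriesSr _ n.+1) opprD addrACA IHn termE.
  by rewrite -mulrDr -seriesSr.
have cz := @cvg_qExp z; have cqz := @cvg_qExp (q * z).
have lhs : (series (qexp_coeff z) n.+1 - series (qexp_coeff (q * z)) n.+1)
    @[n --> \oo] --> qExp q z - qExp q (q * z).
  by apply: cvgB; [rewrite (cvg_shiftS (series (qexp_coeff z)))
                  |rewrite (cvg_shiftS (series (qexp_coeff (q * z))))].
have rhs : ((1 - q) * z * series (qexp_coeff (q * z)) n)
    @[n --> \oo] --> (1 - q) * z * qExp q (q * z).
  by apply: cvgMl_tmp.
move: lhs; rewrite (_ : (fun n => _ - _) =
  (fun n => (1 - q) * z * series (qexp_coeff (q * z)) n)); last exact/funext.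
by move=> lhs; exact: cvg_unique lhs rhs.
Qed.

End qExponential.

Lemma series_lincomb (R : realType) (a : R) (u v : R^nat) :
  cvgn (series u) -> cvgn (series v) ->
  cvgn (series (fun n => a * (u n - v n))) /\
  limn (series (fun n => a * (u n - v n))) =
    a * (limn (series u) - limn (series v)).
Proof.
move=> cu cv; have cuv := is_cvg_seriesB cu cv.
rewrite -[fun n => a * _]/(a *: (u - v)); split; first exact: is_cvg_seriesZ.
by rewrite lim_seriesZ// lim_seriesB.
Qed.

Lemma intsum_lincomb (R : realType) (a : R) (u v : int -> R) :
  intsum_cvg u -> intsum_cvg v ->
  intsum_cvg (fun k => a * (u k - v k)) /\
  intsum (fun k => a * (u k - v k)) = a * (intsum u - intsum v).
Proof.
move=> [cu cuN] [cv cvN].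
have [c e] := series_lincomb a cu cv; have [cN eN] := series_lincomb a cuN cvN.
by split; [split|rewrite /intsum e eN; ring].
Qed.

(** At [z = - q s t] the kernel identity writes the integrand of [t * g t] at [q s] as a multiple of
    the difference of the integrands of [g] at [s] and [q s]. This yields convergence and value
    together. *)
Lemma qderiv_qLaplace (R : realType) (q : R) (g : R -> R) (s : R) :
  0 < q -> q < 1 -> s != 0 ->
  qLaplace_cvg q g s -> qLaplace_cvg q g (q * s) ->
  qLaplace_cvg q (fun t => t * g t) (q * s) /\
  qderiv q (qLaplace q g) s = - q * qLaplace q (fun t => t * g t) (q * s).
Proof.
move=> q_gt0 q_lt1 s_neq0 cs cqs.
have q_neq0 : q != 0 by rewrite gt_eqF.
have q1_neq0 : 1 - q != 0 by rewrite subr_eq0 gt_eqF.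
(* The factor obtained by solving [E(z) - E(q z) = (1 - q) z E(q z)], with [z = - q s t], for
   [t E(q z)]. *)
set c := - (q * (1 - q) * s)^-1.
have termE : (fun k : int => q ^ k *
      (qExp q (- (q * (q * s) * q ^ k)) * (q ^ k * g (q ^ k)))) =
    (fun k : int => c * (q ^ k * (qExp q (- (q * s * q ^ k)) * g (q ^ k)) -
      q ^ k * (qExp q (- (q * (q * s) * q ^ k)) * g (q ^ k)))).
  apply/funext => k; set t := q ^ k.
  rewrite -mulrBr -mulrBl.
  rewrite (_ : - (q * (q * s) * t) = q * - (q * s * t)); last by ring.
  rewrite qExp_qdiff// /c; field.
  by rewrite s_neq0 q1_neq0 q_neq0.
have [c1 e1] := intsum_lincomb c cs cqs.
split; first by rewrite /qLaplace_cvg /jackson_cvg termE.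
rewrite /qderiv /qLaplace /jackson termE e1 /c; field.
by rewrite s_neq0 q1_neq0 q_neq0.
Qed.

(** The scale [a] stays independent of [n] so that induction can run; it becomes [q^-n] only in the
    theorem. Convergence is carried along because each step needs it at two points, coming from [x]
    and [q x]. *)
Lemma iter_qderiv_qLaplace (R : realType) (q a : R) (f : R -> R) (n : nat)
    (x : R) :
  0 < q -> q < 1 -> a != 0 -> x != 0 ->
  (forall i, (i <= n)%N -> qLaplace_cvg q f (a * (q ^+ i * x))) ->
  qLaplace_cvg q (fun t => t ^+ n * f t) (a * (q ^+ n * x)) /\
  iter n (qderiv q) (fun r => qLaplace q f (a * r)) x =
    (- a) ^+ n * q ^+ 'C(n.+1, 2) *
      qLaplace q (fun t => t ^+ n * f t) (a * (q ^+ n * x)).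
Proof.
move=> q_gt0 q_lt1 a_neq0.
have q_neq0 : q != 0 by rewrite gt_eqF.
have q1_neq0 : 1 - q != 0 by rewrite subr_eq0 gt_eqF.
elim: n x => [|n IHn] x x_neq0 cf.
  rewrite (_ : (fun t => t ^+ 0 * f t) = f); last first.
    by apply/funext => t; rewrite expr0 mul1r.
  split; first exact: cf.
  by rewrite /= !expr0 !mul1r.
have [||c0 e0] := IHn x => //; first by move=> i i_n; apply: cf; rewrite ltnW.
have [||c1 e1] := IHn (q * x).
- by rewrite mulf_neq0.
- by move=> i i_n; rewrite [q ^+ i * _]mulrA -exprSr; exact: cf.
set y := a * (q ^+ n * x) in c0 e0.
have y_neq0 : y != 0 by rewrite !mulf_neq0// expf_neq0.
have qyE : a * (q ^+ n * (q * x)) = q * y by rewrite /y; ring.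
rewrite qyE in c1 e1.
have [c e] := qderiv_qLaplace q_gt0 q_lt1 y_neq0 c0 c1.
have fE : (fun t => t ^+ n.+1 * f t) = (fun t => t * (t ^+ n * f t)).
  by apply/funext => t; rewrite exprS mulrA.
have qySE : a * (q ^+ n.+1 * x) = q * y by rewrite /y exprS; ring.
rewrite fE qySE; split => //=.
rewrite {1}/qderiv e0 e1 (binS n.+1) bin1 exprD
  [(- a) ^+ n.+1]exprS [q ^+ n.+1]exprS.
set h := (fun t : R => t ^+ n * f t) in e *.
set L := qLaplace q (fun t => t * h t) (q * y) in e *.
(* The outer quotient divides by [(1 - q) x], not [(1 - q) y]. Since [y / x = a q^n], the step
   contributes [- a q^(n+1)], in line with [C(n+2,2) - C(n+1,2) = n+1]. *)
have {}e : qLaplace q h y - qLaplace q h (q * y) = - q * L * ((1 - q) * y).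
  by rewrite -e /qderiv divfK// mulf_neq0.
rewrite -mulrBr e /y; field.
by rewrite x_neq0 q1_neq0.
Qed.

(* The n-th q-derivative at s of r |-> F(q^-n r) samples F exactly at the      *)
(* points q^-k s for 0 <= k <= n.                                              *)
Theorem theorem4 (R : realType) (q : R) (f : R -> R) (n : nat) (s : R)
    (q_gt0 : 0 < q) (q_lt1 : q < 1) (s_gt0 : 0 < s)
    (cvgF : forall k : nat, (k <= n)%N -> qLaplace_cvg q f (q ^- k * s))
    (cvgtf : qLaplace_cvg q (fun t : R => t ^+ n * f t) s) :
  qLaplace q (fun t : R => t ^+ n * f t) s =
  (-1) ^+ n * q ^+ 'C(n, 2) *
    iter n (qderiv q) (fun r : R => qLaplace q f (q ^- n * r)) s.
Proof.
have q_neq0 : q != 0 by rewrite gt_eqF.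
have qX_neq0 m : q ^+ m != 0 by rewrite expf_neq0.
have [||i i_n|_ ->] := @iter_qderiv_qLaplace R q (q ^- n) f n s q_gt0 q_lt1.
- by rewrite invr_neq0.
- by rewrite gt_eqF.
- rewrite mulrA (_ : q ^- n * q ^+ i = q ^- (n - i)); last first.
    by rewrite -{1}(subnK i_n) exprD invfM mulfVK.
  exact/cvgF/leq_subr.
rewrite mulKf// mulrA [X in X * _](_ : _ = 1) ?mul1r//.
(* With [a = q^-n], the factor [(- a)^n] carries [q^(- n^2)], which these two binomial exponents
   cancel; the two signs square to 1. *)
have binE : ('C(n, 2) + 'C(n.+1, 2) = n * n)%N.
  by rewrite binS bin1; elim: n {cvgF cvgtf} => // n IHn; rewrite binS bin1; lia.
rewrite [(- q ^- n) ^+ n]exprNn mulrACA [X in X * _]mulrA -expr2 sqrr_sign mul1r.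
by rewrite -exprD binE exprVn -exprM mulVf.
Qed.
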